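(* Let $X$ be either a normed space over $\mathbb{R}$ of dimension $\dim X\ge 1$, or an Hadamard space containing more than one point. Let $n\ge 2$ be an integer. If $r\colon X(n)\to X(n-1)$ is a Lipschitz retraction, then $\operatorname{Lip}(r)\ge n-3$.
   Context: For a metric space $(X,d)$ and a positive integer $n$, $X(n)$ denotes the $n$th finite subset space of $X$: the set of all nonempty subsets of $X$ of cardinality at most $n$, with the Hausdorff distance $d_H(A,B)=\max\{\max_{a\in A}\min_{b\in B}d(a,b),\ \max_{b\in B}\min_{a\in A}d(a,b)\}$. For $k\le n$ we regard $X(k)\subset X(n)$. A normed space carries the metric induced by its norm. A map $f\colon M\to N$ between metric spaces is Lipschitz if there is $L\ge 0$ with $d(f(x),f(x'))\le L\,d(x,x')$ for all $x,x'\in M$; the least such $L$ is denoted $\operatorname{Lip}(f)$. If $N\subset M$, a Lipschitz retraction $r\colon M\to N$ is a Lipschitz map whose restriction to $N$ is the identity. A geodesic in a metric space $(X,d)$ is a map $\gamma\colon[0,1]\to X$ with $d(\gamma(t),\gamma(s))=|t-s|\,d(\gamma(0),\gamma(1))$ for all $t,s\in[0,1]$; $X$ is a geodesic space if for any $p,q\in X$ there is a geodesic with $\gamma(0)=p$, $\gamma(1)=q$. A complete geodesic space $X$ is an Hadamard space if for every point $z\in X$, every geodesic $\gamma$ and every $t\in[0,1]$, $$d(\gamma(t),z)^2\le (1-t)\,d(\gamma(0),z)^2+t\,d(\gamma(1),z)^2-t(1-t)\,d(\gamma(0),\gamma(1))^2 .$$ *)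

(* Defs.v *)
From HB Require Import structures.
From mathcomp Require Import all_boot all_order all_algebra finmap.
From mathcomp Require Import all_classical all_reals all_analysis.

Set Implicit Arguments.
Unset Strict Implicit.
Unset Printing Implicit Defensive.

Import Order.TTheory GRing.Theory Num.Theory.
Import numFieldNormedType.Exports.

Local Open Scope classical_set_scope.
Local Open Scope ring_scope.

(* The library does not equip a [normedModType] with its [metricType]
   structure; this alias carries it. *)
Definition normed_metric (R : realType) (X : normedModType R) : Type := X.

Section NormedMetric.
Variables (R : realType) (X : normedModType R).
Implicit Types x y : X.

Let dist x y : R := `|x - y|.

Let dist_ge0 x y : 0 <= dist x y. Proof. exact: normr_ge0. Qed.

Let dist_positivity x y : dist x y = 0 -> x = y.
Proof. by move/normr0_eq0/subr0_eq. Qed.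

Let ballEdist x d : ball x d = [set y | dist x y < d].
Proof. by rewrite -ball_normE. Qed.

HB.instance Definition _ := PseudoMetric.copy (normed_metric X) X.
HB.instance Definition _ := PseudoMetric_isMetric.Build R (normed_metric X)
  dist_ge0 dist_positivity ballEdist.

Lemma normed_mdistE x y :
  mdist (x : normed_metric X) (y : normed_metric X) = `|x - y|.
Proof. by []. Qed.

End NormedMetric.

Section FiniteSubsets.
Variables (R : realType) (X : metricType R).

Record finsub (n : nat) := FinSub {
  finsub_val :> {fset X};
  _ : (finsub_val != fset0) && (#|` finsub_val| <= n)%N }.

HB.instance Definition _ n := [isSub for @finsub_val n].
HB.instance Definition _ n := [Choice of finsub n by <:].

Lemma finsub_neq0 n (A : finsub n) : (A : {fset X}) != fset0.
Proof. by case: A => A /= /andP[]. Qed.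

Lemma finsub_card n (A : finsub n) : (#|` A| <= n)%N.
Proof. by case: A => A /= /andP[]. Qed.

Lemma finsub_incl_subproof k n (kn : (k <= n)%N) (A : finsub k) :
  ((A : {fset X}) != fset0) && (#|` A| <= n)%N.
Proof. by rewrite finsub_neq0 (leq_trans (finsub_card A)). Qed.

Definition finsub_incl k n (kn : (k <= n)%N) (A : finsub k) : finsub n :=
  FinSub (finsub_incl_subproof kn A).

(* The infimum and suprema below range over finite nonempty sets of reals, so
   they are a minimum and maxima: see [pdist_min] and [hdist_max]. *)
Definition pdist (a : X) (B : {fset X}) : R :=
  inf [set mdist a b | b in [set` B]].

Definition hdist (A B : {fset X}) : R :=
  Num.max (sup [set pdist a B | a in [set` A]])
          (sup [set pdist b A | b in [set` B]]).

Lemma finite_max_attained (f : X -> R) (A : {fset X}) : A != fset0 ->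
  exists2 a, a \in A & forall x, x \in A -> f x <= f a.
Proof.
case/fset0Pn => a0 a0A.
have [a _ am] := @Order.TotalTheory.arg_maxP _ R A [` a0A]%fset xpredT
  (fun x => f (val x)) isT.
exists (val a); first exact: valP.
by move=> x xA; exact: (am [` xA]%fset isT).
Qed.

Lemma finite_sup_max (f : X -> R) (A : {fset X}) : A != fset0 ->
  (exists2 a, a \in A & sup [set f x | x in [set` A]] = f a) /\
  (forall a, a \in A -> f a <= sup [set f x | x in [set` A]]).
Proof.
move=> /(finite_max_attained f)[a aA am].
have supE : sup [set f x | x in [set` A]] = f a.
  apply/eqP; rewrite eq_le; apply/andP; split.
    by apply: ge_sup => [|_ [x xA <-]]; [exists (f a), a | exact: am].
  apply: ub_le_sup; last by exists a.
  by exists (f a) => _ [x xA <-]; exact: am.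
by rewrite supE; split => //; exists a.
Qed.

Lemma pdist_min (a : X) (B : {fset X}) : B != fset0 ->
  (exists2 b, b \in B & pdist a B = mdist a b) /\
  (forall b, b \in B -> pdist a B <= mdist a b).
Proof.
move=> /(finite_sup_max (fun b => - mdist a b))[[b bB e] m].
have E : pdist a B = - sup [set - mdist a x | x in [set` B]].
  by rewrite /pdist /inf image_comp.
rewrite E; split => [|c cB]; first by exists b => //; rewrite e opprK.
by rewrite lerNl; exact: m.
Qed.

Lemma hdist_max (A B : {fset X}) : A != fset0 -> B != fset0 ->
  ((exists2 a, a \in A & hdist A B = pdist a B) \/
   (exists2 b, b \in B & hdist A B = pdist b A)) /\
  (forall a, a \in A -> pdist a B <= hdist A B) /\
  (forall b, b \in B -> pdist b A <= hdist A B).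
Proof.
move=> /(finite_sup_max (pdist^~ B))[[a aA ea] ma].
move=> /(finite_sup_max (pdist^~ A))[[b bB eb] mb].
split; last first.
  by split=> [x /ma|x /mb] xm; rewrite /hdist le_max xm ?orbT.
rewrite /hdist ea eb; case: leP => _; [right; exists b|left; exists a] => //.
Qed.

Lemma hdist_le (A B : {fset X}) (e : R) : A != fset0 -> B != fset0 ->
  hdist A B <= e <->
  (forall a, a \in A -> exists2 b, b \in B & mdist a b <= e) /\
  (forall b, b \in B -> exists2 a, a \in A & mdist b a <= e).
Proof.
move=> A0 B0; have [h [hA hB]] := hdist_max A0 B0.
split=> [le_e|[lA lB]].
  split=> x xin.
    have [[b bB E] _] := pdist_min x B0; exists b => //.
    by rewrite -E (le_trans (hA _ xin)).
  have [[b bB E] _] := pdist_min x A0; exists b => //.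
  by rewrite -E (le_trans (hB _ xin)).
case: h => [[x xin ->]|[x xin ->]].
  have [y yin /(le_trans _)->//] := lA x xin.
  exact: (pdist_min x B0).2.
have [y yin /(le_trans _)->//] := lB x xin.
exact: (pdist_min x A0).2.
Qed.

Lemma hdist_sym (A B : {fset X}) : hdist A B = hdist B A.
Proof. by rewrite /hdist maxC. Qed.

Section FinsubMetric.
Variable n : nat.
Implicit Types A B C : finsub n.

Let d A B : R := hdist A B.

Let d_ge0 A B : 0 <= d A B.
Proof.
have [[[a _ e]|[b _ e]] _] := hdist_max (finsub_neq0 A) (finsub_neq0 B).
  rewrite /d e; have [[b _ ->] _] := pdist_min a (finsub_neq0 B).
  exact: mdist_ge0.
rewrite /d e; have [[a _ ->] _] := pdist_min b (finsub_neq0 A).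
exact: mdist_ge0.
Qed.

Let dxx A : d A A = 0.
Proof.
apply/eqP; rewrite eq_le d_ge0 andbT.
by apply/hdist_le; rewrite ?finsub_neq0//; split=> a aA; exists a;
  rewrite ?mdistxx.
Qed.

Let d_positivity A B : d A B = 0 -> A = B.
Proof.
move=> d0; have := lexx (d A B); rewrite {2}d0.
case/hdist_le => [||lA lB]; rewrite ?finsub_neq0//.
have z (x y : X) : mdist x y <= 0 -> x = y.
  by move=> le0; apply: mdist_positivity; apply/eqP; rewrite eq_le le0 mdist_ge0.
apply/val_inj/fsetP => x; apply/idP/idP => xin.
  by have [y yB /z ->] := lA x xin.
by have [y yB /z ->] := lB x xin.
Qed.

Let d_sym A B : d A B = d B A. Proof. exact: hdist_sym. Qed.

Let d_triangle B A C : d A C <= d A B + d B C.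
Proof.
have := lexx (d A B); case/hdist_le; rewrite ?finsub_neq0// => AB BA.
have := lexx (d B C); case/hdist_le; rewrite ?finsub_neq0// => BC CB.
apply/hdist_le; rewrite ?finsub_neq0//; split=> [a aA|c cC].
  have [b bB ab] := AB a aA; have [c cC bc] := BC b bB.
  by exists c => //; rewrite (le_trans (metric_triangle a b c))// lerD.
have [b bB cb] := CB c cC; have [a aA ba] := BA b bB.
by exists a => //; rewrite (le_trans (metric_triangle c b a))// addrC lerD.
Qed.

HB.instance Definition _ := isMetric.Build R (finsub n)
  dxx d_positivity d_sym d_triangle.

End FinsubMetric.

End FiniteSubsets.

Lemma finsub_mdistE (R : realType) (X : metricType R) n (A B : finsub X n) :
  mdist A B = hdist A B.
Proof. by []. Qed.

Lemma finsub_incl_isometry (R : realType) (X : metricType R) k n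
    (kn : (k <= n)%N) (A B : finsub X k) :
  mdist (finsub_incl kn A) (finsub_incl kn B) = mdist A B.
Proof. by []. Qed.

Section Lipschitz.
Variables (R : realType) (M N : metricType R).

Definition lipschitz_const (f : M -> N) (L : R) : Prop :=
  0 <= L /\ forall x x', mdist (f x) (f x') <= L * mdist x x'.

Definition is_lipschitz (f : M -> N) : Prop := exists L, lipschitz_const f L.

(* The infimum is attained for a Lipschitz map: see [Lip_least]. *)
Definition Lip (f : M -> N) : R := inf [set L | lipschitz_const f L].

Lemma Lip_least (f : M -> N) : is_lipschitz f ->
  lipschitz_const f (Lip f) /\ forall L, lipschitz_const f L -> Lip f <= L.
Proof.
move=> [L0 L0f]; have lb : has_lbound [set L | lipschitz_const f L].
  by exists 0 => L [].
split; last by move=> L Lf; exact: ge_inf.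
split; first by apply: lb_le_inf => [|L []]//; exists L0.
move=> x x'; have [xx|] := eqVneq x x'.
  by rewrite xx !mdistxx mulr0.
rewrite -mdist_gt0 => xx; rewrite -ler_pdivrMr//.
apply: lb_le_inf => [|L [_ Lf]]; first by exists L0.
by rewrite ler_pdivrMr.
Qed.

(* [i] is the inclusion of the subspace [N] in [M]. *)
Definition lipschitz_retraction (i : N -> M) (r : M -> N) : Prop :=
  is_lipschitz r /\ cancel i r.

End Lipschitz.

Section Hadamard.
Variables (R : realType) (X : metricType R).

(* Only the restriction of [gamma] to [0, 1] matters. *)
Definition geodesic (gamma : R -> X) : Prop :=
  forall t s, 0 <= t <= 1 -> 0 <= s <= 1 ->
    mdist (gamma t) (gamma s) = `|t - s| * mdist (gamma 0) (gamma 1).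

Definition geodesic_space : Prop :=
  forall p q : X, exists gamma, [/\ geodesic gamma, gamma 0 = p & gamma 1 = q].

(* The library's [cauchy_cvg], without its requirement that [X] be pointed. *)
Definition complete_space : Prop :=
  forall F : set_system X, ProperFilter F -> cauchy F ->
    exists l : X, F --> l.

Definition hadamard_space : Prop :=
  [/\ complete_space, geodesic_space &
    forall (z : X) (gamma : R -> X) (t : R), geodesic gamma -> 0 <= t <= 1 ->
      mdist (gamma t) z ^+ 2 <=
        (1 - t) * mdist (gamma 0) z ^+ 2 + t * mdist (gamma 1) z ^+ 2
        - t * (1 - t) * mdist (gamma 0) (gamma 1) ^+ 2].

End Hadamard.

(* Also meaningful when [V] is infinite-dimensional. *)
Definition dim_ge (R : realType) (V : lmodType R) (k : nat) : Prop :=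
  exists v : 'I_k -> V, forall c : 'I_k -> R,
    \sum_(i < k) c i *: v i = 0 -> forall i, c i = 0.

(* Main.v *)
Require Import Defs.
From mathcomp Require Import all_boot all_order all_algebra finmap.
From mathcomp Require Import all_classical all_reals all_analysis.
From mathcomp Require Import zify ring lra.
Import Order.TTheory GRing.Theory Num.Theory.
Import numFieldNormedType.Exports.
Local Open Scope ring_scope.

(* Only a geodesic g : [0, 2N] -> X matters; the rescaled distance to g(0) is a
   1-Lipschitz left inverse of g.  Take m even with n = m + 2 or n = m + 3, and
   suppose L = Lip(r) < m.  Consider the m-simplex of sets {0, t_1, ..., t_m, N}
   (together with the point 2N when n is odd).  Merging the two closest points of
   such a set moves it by at most N / (2(m + 1)), so r displaces it by at most
   (L + 1) N / (2(m + 1)) < N / 2: the part of the image close to [0, N] keeps a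
   width comparable to N and has at most m + 1 points, and it depends
   continuously on t.  On each of the m + 1 faces of the simplex r is the
   identity, and all these faces carry the same sets {0, s_1, ..., s_{m-1}, N}.
   So the boundary of the simplex would map with degree m + 1 mod 2, which is 1,
   onto the interior of the space of (m + 1)-point sets of normalised endpoints,
   and yet extend over the simplex.  The degree argument is made discrete, in
   the style of Sperner's lemma: N is a large multiple of m, and sets are
   labelled by their position relative to m + 1 equally spaced nodes. *)

(** * Sperner parity for the simplex of finite sets *)

Section Words.
Local Open Scope nat_scope.

(** * Counting words modulo 2 *)

Section WordSums.
Variable N : nat.

Fixpoint wsum (m : nat) (F : seq nat -> bool) : bool :=
  if m is p.+1 then \big[addb/false]_(0 <= a < N) wsum p (fun u => F (a :: u))
  else F [::].

Lemma eq_wsum (m : nat) (F G : seq nat -> bool) :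
  (forall u, size u = m -> all (gtn N) u -> F u = G u) -> wsum m F = wsum m G.
Proof.
elim: m F G => [|m IH] F G FG /=; first exact: FG.
apply: eq_big_nat => a /andP[_ aN]; apply: IH => u su uN.
by apply: FG => /=; rewrite ?su// aN.
Qed.

Lemma wsum_cat (a b : nat) (F : seq nat -> bool) :
  wsum (a + b) F = wsum a (fun u => wsum b (fun v => F (u ++ v))).
Proof. by elim: a F => //= a IH F; apply: eq_bigr => c _; exact: IH. Qed.

Lemma wsum_big (I : Type) (s : seq I) (m : nat) (F : I -> seq nat -> bool) :
  wsum m (fun u => \big[addb/false]_(i <- s) F i u) =
  \big[addb/false]_(i <- s) wsum m (F i).
Proof.
elim: m F => //= m IH F; rewrite exchange_big /=.
by apply: eq_bigr => a _; exact: IH.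
Qed.

Lemma wsum_exists (m : nat) (F : seq nat -> bool) : wsum m F ->
  exists y, [/\ size y = m, all (gtn N) y & F y].
Proof.
elim: m F => [|m IH] F /=; first by move=> F0; exists [::].
have [/hasP[a]|nF] := boolP (has (fun a => wsum m (fun u => F (a :: u))) (index_iota 0 N)).
  rewrite mem_index_iota => /andP[_ aN] /IH[y [sy yN Fy]] _.
  by exists (a :: y); rewrite /= sy aN.
rewrite big_seq big1 // => a aN; apply/negbTE; exact: (hasPn nF).
Qed.

Lemma wsum_pred1 (m : nat) (F : seq nat -> bool) (z : seq nat) :
  size z = m -> all (gtn N) z ->
  (forall u, size u = m -> all (gtn N) u -> F u = (u == z)) -> wsum m F.
Proof.
elim: m F z => [|m IH] F z /=.
  by move=> /size0nil -> _ ->.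
case: z => // b z [sz] /= /andP[bN zN] Fz.
rewrite (bigD1_seq b) ?mem_index_iota ?iota_uniq //=.
rewrite (IH _ z) //; last by move=> u su uN; rewrite Fz /= ?su ?bN// eqseq_cons eqxx.
rewrite big_seq_cond big1 // => a /andP[]; rewrite mem_index_iota /= => aN ab.
apply/negbTE/negP => /wsum_exists[u [su uN]].
by rewrite Fz /= ?su ?uN ?andbT// eqseq_cons (negbTE ab).
Qed.

(* Off the diagonal, the terms of a symmetric double sum cancel in pairs. *)
Lemma sum_sym_diag (F : nat -> nat -> bool) : (forall p q, F p q = F q p) ->
  \big[addb/false]_(0 <= p < N) \big[addb/false]_(0 <= q < N) F p q =
  \big[addb/false]_(0 <= p < N) F p p.
Proof.
move=> Fs; elim: N => [|n IH]; first by rewrite !big_geq.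
rewrite !big_nat_recr //=.
under eq_bigr do rewrite big_nat_recr //=.
rewrite big_split /= IH.
under [X in _ (+) X (+) _]eq_bigr do rewrite Fs.
by rewrite addbA addbK.
Qed.

End WordSums.

(* The unordered words [vert 0 y, ..., vert m y] are the vertices of a simplex of
   the edgewise subdivision of [0 <= t_1 <= ... <= t_m <= N]; every simplex
   arises from exactly one word [y] over [0, N). *)
Definition vert (k : nat) (y : seq nat) : seq nat :=
  map succn (take k y) ++ drop k y.

Lemma size_vert k y : size (vert k y) = size y.
Proof. by rewrite size_cat size_map -size_cat cat_take_drop. Qed.

Lemma all_vert k y N : all (gtn N) y -> all (geq N) (vert k y).
Proof.
move=> /allP yN; rewrite all_cat all_map; apply/andP; split; apply/allP => a.
  by move=> /mem_take /yN.
by move=> /mem_drop /yN /ltnW.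
Qed.

Lemma nth_vert k y i : i < size y -> nth 0 (vert k y) i = nth 0 y i + (i < k).
Proof.
move=> iy; rewrite /vert nth_cat size_map size_take_min leq_min iy andbT.
case: ltnP => ik.
  by rewrite (nth_map 0) ?size_take_min ?leq_min ?ik// nth_take// addn1.
by rewrite nth_drop addn0 minnE; congr nth; lia.
Qed.

Lemma vert_cat_le k u v : k <= size u -> vert k (u ++ v) = vert k u ++ v.
Proof.
move=> ku; rewrite /vert takel_cat// drop_cat -catA.
by case: ltngtP ku => // ->; rewrite subnn drop0 drop_size.
Qed.

Lemma vert_cat_ge k u v : size u <= k ->
  vert k (u ++ v) = map succn u ++ vert (k - size u) v.
Proof.
move=> ku; rewrite /vert take_cat drop_cat.
by case: ltngtP ku => // [_ _|->]; rewrite ?map_cat ?catA// subnn take0 drop0 cats0.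
Qed.

(** * Rainbow facets of the subdivided simplex and their parity *)

Section Sperner.
Variables (N : nat) (lab : seq nat -> nat).
(* The label of [s] depends only on the finite set [{0, N} + s]. *)
Hypothesis lab_eq : forall s1 s2,
  [:: 0, N & s1] =i [:: 0, N & s2] -> lab s1 = lab s2.

(** A rainbow facet: vertex [k] is left out, and the other [m] vertices carry each of the labels
    [1, ..., m] once. *)
Definition facet (m k : nat) (y : seq nat) : bool :=
  perm_eq [seq lab (vert j y) | j <- iota 0 k ++ iota k.+1 (m - k)] (iota 1 m).

(** The rainbow condition on the boundary, for words [z] of [m - 1] letters: the prepended [0]
    repeats an endpoint and so adds nothing to the set. *)
Definition face (m : nat) (z : seq nat) : bool :=
  perm_eq [seq lab (0 :: vert j z) | j <- iota 0 m] (iota 1 m).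

Lemma lab_mem (s1 s2 : seq nat) : s1 =i s2 -> lab s1 = lab s2.
Proof. by move=> s12; apply: lab_eq => x; rewrite !inE s12. Qed.

(** Letters [k - 1] and [k] (counted from 0) are both raised or both unraised in every vertex but
    the [k]th, so the facet cannot see their order: the two words are neighbours across it. *)
Lemma facet_swap (m k : nat) (u v : seq nat) (p q : nat) : k = (size u).+1 ->
  facet m k (u ++ p :: q :: v) = facet m k (u ++ q :: p :: v).
Proof.
move=> ku; rewrite /facet; congr perm_eq; apply/eq_in_map => j.
rewrite mem_cat !mem_iota => jk; apply: lab_mem => x.
have [ju|ju] := leqP j (size u).
  by rewrite !vert_cat_le// !mem_cat !inE; congr orb; rewrite orbCA.
rewrite !vert_cat_ge 1?ltnW//.
have -> : j - size u = (j - size u - 2).+2 by lia.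
by rewrite /vert /= !mem_cat !inE; congr orb; rewrite orbCA.
Qed.

Lemma facet_diag (m k : nat) (u v : seq nat) (p : nat) :
  k = (size u).+1 -> k <= m ->
  facet m k (u ++ p :: p :: v) = face m (u ++ p :: v).
Proof.
move=> ku km; rewrite /facet /face; congr perm_eq.
rewrite (_ : iota 0 m = iota 0 k ++ iota k (m - k)); last first.
  by rewrite -{1}(subnKC km) iotaD.
rewrite !map_cat.
congr (_ ++ _).
  apply/eq_in_map => j; rewrite mem_iota => jk; apply: lab_eq => x.
  by rewrite !vert_cat_le ?inE ?mem_cat ?inE; lia.
rewrite -add1n iotaDl -map_comp; apply/eq_in_map => j.
rewrite mem_iota => jk; apply: lab_eq => x.
rewrite /= !vert_cat_ge; try lia.
have -> : 1 + j - size u = (j - size u).+1 by lia.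
have -> : j - size u = (j - size u).-1.+1 by lia.
by rewrite /vert /= !(inE, mem_cat); do ! case: (_ == _); rewrite /= ?orbT.
Qed.

(** Neighbouring words cancel in pairs; what survives is the diagonal, which is a boundary face. *)
Lemma wsum_facet_inner (m k : nat) : 0 < k < m ->
  wsum N m (facet m k) = wsum N m.-1 (face m).
Proof.
move=> /andP[k0 km].
rewrite [in LHS](_ : m = k.-1 + (2 + (m - k.+1))); last lia.
rewrite wsum_cat [in RHS](_ : m.-1 = k.-1 + (1 + (m - k.+1))); last lia.
rewrite wsum_cat; apply: eq_wsum => u su _.
rewrite -(_ : m = k.-1 + (2 + (m - k.+1))); last lia.
have ku : k = (size u).+1 by lia.
rewrite /= sum_sym_diag; last first.
  by move=> p q; apply: eq_wsum => v _ _; apply: facet_swap.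
apply: eq_bigr => p _; apply: eq_wsum => v _ _; apply: facet_diag => //; lia.
Qed.

(* Forgetting [vert 0] of [a :: u] leaves the same facet as forgetting the last
   vertex of the word [rcons u a.+1]. *)
Lemma facet_rot (m a : nat) (u : seq nat) : size u = m ->
  facet m.+1 0 (a :: u) = facet m.+1 m.+1 (rcons u a.+1).
Proof.
move=> um; rewrite /facet subnn subn0 cats0 cat0s (iotaDl 1 0) -map_comp.
congr perm_eq; apply/eq_in_map => j; rewrite mem_iota => jm; apply: lab_mem => x.
rewrite -cats1 vert_cat_le; last lia.
by rewrite /= /vert /= inE !mem_cat !inE orbC.
Qed.

Lemma facet_last (m b : nat) (u : seq nat) : size u = m -> (b == 0) || (b == N) ->
  facet m.+1 m.+1 (rcons u b) = face m.+1 u.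
Proof.
move=> um bN; rewrite /facet /face subnn cats0.
congr perm_eq; apply/eq_in_map => j; rewrite mem_iota => jm; apply: lab_eq => x.
rewrite -cats1 vert_cat_le; last lia.
rewrite !(inE, mem_cat); case/orP: bN => /eqP ->.
  by do ! case: (_ == _) => //=; rewrite ?orbT ?orbF.
by do ! case: (_ == _) => //=; rewrite ?orbT ?orbF.
Qed.

(** After [facet_rot], the left side runs over last letters [1, ..., N] and the right side over
    [0, ..., N - 1]. The end terms [0] and [N] agree by [facet_last]. *)
Lemma wsum_facet_outer (m : nat) : 0 < m ->
  wsum N m (facet m 0) = wsum N m (facet m m).
Proof.
case: m => // m _.
have wr F : wsum N m.+1 F = wsum N m (fun u => \big[addb/false]_(0 <= a < N) F (rcons u a)).
  rewrite -[in LHS]addn1 wsum_cat /=; apply: eq_wsum => u _ _.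
  by apply: eq_bigr => a _; rewrite cats1.
rewrite [in RHS]wr /= -wsum_big; apply: eq_wsum => u um _.
under eq_bigr do rewrite facet_rot//.
have [->|N0] := posnP N; first by rewrite !big_geq.
have := @big_nat_recl _ false addb N 0 (fun a => facet m.+1 m.+1 (rcons u a)) isT.
rewrite big_nat_recr //= !facet_last ?eqxx ?orbT// => e.
by rewrite addbC in e; move/addbI: e => ->.
Qed.

(** An odd number of rainbow facets means exactly one: if the left-out vertex had a label in
    [1, ..., m], it could replace the vertex with the same label, giving a second one. *)
Lemma sum_facets (m : nat) (y : seq nat) :
  \big[addb/false]_(0 <= k < m.+1) facet m k y ->
  exists2 k, k <= m & facet m k y /\ lab (vert k y) \notin iota 1 m.
Proof.
set l := fun k => lab (vert k y).
have lE k : k <= m -> facet m k y =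
    perm_eq [seq l j | j <- iota 0 m.+1] (l k :: iota 1 m).
  move=> km; rewrite [iota 0 m.+1](_ : _ = iota 0 k ++ k :: iota k.+1 (m - k)); last first.
    by rewrite -{1}(subnKC km) -addnS iotaD.
  rewrite map_cat /= (perm_catCA _ [:: l k]) /= perm_cons.
  by rewrite -map_cat.
have [/hasP[k]|nF] := boolP (has (facet m ^~ y) (index_iota 0 m.+1)); last first.
  rewrite big_seq big1 // => a aN; apply/negbTE; exact: (hasPn nF).
rewrite mem_index_iota ltnS => /andP[_ km] fk sumk.
exists k => //; split => //; apply/negP => lk.
have pk := fk; rewrite lE // in pk.
have : \big[addb/false]_(0 <= j < m.+1) facet m j y =
       odd (count_mem (l k) [seq l j | j <- iota 0 m.+1]).
  rewrite count_map -sum1_count [in RHS]big_mkcond /index_iota subn0.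
  rewrite (big_morph odd oddD (erefl : odd 0 = false)) big_seq [in RHS]big_seq.
  apply: eq_bigr => j; rewrite mem_iota ltnS => jm; rewrite lE //.
  rewrite (permPl pk) /= -cat1s -[l j :: _]cat1s perm_cat2r.
  rewrite (_ : perm_eq _ _ = (l k == l j)) 1?eq_sym; first by case: eqP.
  apply/idP/eqP => [/perm_mem/(_ (l k))|->//].
  by rewrite !inE eqxx => /esym/eqP.
rewrite sumk; move/permP: pk => /(_ (pred1 (l k))) ->.
by rewrite /= eqxx count_uniq_mem ?iota_uniq// lk.
Qed.

(** Pairs of a simplex and a rainbow facet are counted modulo 2. The two outer facets cancel, each
    of the [m - 1] inner ones contributes the parity of the boundary count, and [m - 1] is odd. *)
Theorem sperner_words (m : nat) : 0 < m -> ~~ odd m -> wsum N m.-1 (face m) ->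
  exists y, [/\ size y = m, all (gtn N) y,
    forall j, 0 < j <= m -> exists2 k, k <= m & lab (vert k y) = j &
    exists2 k, k <= m & ~~ (0 < lab (vert k y) <= m)].
Proof.
move=> m0 mo fm.
have : wsum N m (fun y => \big[addb/false]_(0 <= k < m.+1) facet m k y).
  rewrite wsum_big big_nat_recr //= big_ltn // wsum_facet_outer //.
  rewrite addbAC addbb addFb.
  under eq_big_nat => k km do rewrite wsum_facet_inner //.
  have iter_odd p : iter p (addb true) false = odd p by elim: p => //= p ->.
  rewrite fm big_const_nat iter_odd.
  by case: m m0 mo {fm} => // m _; rewrite /= negbK subSS subn0.
move=> /wsum_exists[y [sy yN /sum_facets[k km [fk lk]]]]; exists y; split => //.
  move=> j jm; have : j \in iota 1 m by rewrite mem_iota add1n ltnS.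
  rewrite -(perm_mem fk) => /mapP[i]; rewrite mem_cat !mem_iota => ik ->.
  by exists i => //; lia.
by exists k => //; rewrite mem_iota add1n ltnS in lk.
Qed.

End Sperner.

End Words.

(** * Labels of finite sets of reals *)

Section Labels.
Variable R : realFieldType.
Implicit Types B : seq R.

(** The default [head 0 B] lies in [B] unless [B] is empty, so it never alters the extremum. *)
Definition hi B : R := \big[Num.max/head 0 B]_(b <- B) b.
Definition lo B : R := \big[Num.min/head 0 B]_(b <- B) b.

Lemma hi_mem B : B != [::] -> hi B \in B.
Proof.
move=> B0; rewrite /hi big_seq; apply: (big_ind (fun x => x \in B)) => //.
  by case: B B0 => // b B _; rewrite mem_head.
by move=> x y xB yB; case: leP.
Qed.

Lemma lo_mem B : B != [::] -> lo B \in B.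
Proof.
move=> B0; rewrite /lo big_seq; apply: (big_ind (fun x => x \in B)) => //.
  by case: B B0 => // b B _; rewrite mem_head.
by move=> x y xB yB; case: leP.
Qed.

Lemma le_hi B b : b \in B -> b <= hi B.
Proof. by move=> bB; exact: le_bigmax_seq. Qed.

Lemma lo_le B b : b \in B -> lo B <= b.
Proof. by move=> bB; exact: ge_bigmin_seq. Qed.

Lemma hi_close B B' (e : R) : B != [::] -> B' != [::] ->
  (forall b, b \in B -> exists2 b', b' \in B' & `|b - b'| <= e) ->
  hi B <= hi B' + e.
Proof.
move=> B0 B'0 BB'; have [b' /le_hi b'h] := BB' _ (hi_mem B B0).
by rewrite ler_norml => /andP[_]; lra.
Qed.

Lemma lo_close B B' (e : R) : B != [::] -> B' != [::] ->
  (forall b, b \in B -> exists2 b', b' \in B' & `|b - b'| <= e) ->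
  lo B' - e <= lo B.
Proof.
move=> B0 B'0 BB'; have [b' /lo_le b'h] := BB' _ (lo_mem B B0).
by rewrite ler_norml => /andP[+ _]; lra.
Qed.

(** * Nodes and labels *)

Variables (m : nat) (eta : R).
Hypothesis m_gt0 : (0 < m)%N.

Let m_gt0R : 0 < m%:R :> R. Proof. by rewrite ltr0n. Qed.

Definition node B (j : nat) : R := lo B + j%:R / m%:R * (hi B - lo B).

(** The inner nodes are [1, ..., m - 1]; nodes [0] and [m] are the extremes of [B]. *)
Definition near_nodes B : bool :=
  all (fun j => has (fun b => `|b - node B j| <= eta) B) (iota 1 m.-1).

Definition below_node B (j : nat) : bool :=
  has (fun b => node B j - eta <= b < node B j) B.

(* The first node with a point just below it ([m] if there is none), or [0] when
   some node has no point nearby. *)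
Definition label B : nat :=
  if near_nodes B then (find (below_node B) (iota 1 m.-1)).+1 else 0.

Lemma label_gt0 B : (0 < label B)%N = near_nodes B.
Proof. by rewrite /label; case: ifP. Qed.

Lemma label_le B : (label B <= m)%N.
Proof.
rewrite /label; case: ifP => // _; rewrite -[leqRHS](prednK m_gt0) ltnS.
by rewrite -[leqRHS](size_iota 1) find_size.
Qed.

Lemma label_below B : (0 < label B < m)%N -> below_node B (label B).
Proof.
rewrite /label; case: ifP => // _ /andP[_ lm].
have fm : (find (below_node B) (iota 1 m.-1) < size (iota 1 m.-1))%N.
  by rewrite size_iota; lia.
have := fm; rewrite -has_find => /(nth_find 0%N).
by rewrite nth_iota //; rewrite size_iota in fm.
Qed.

Lemma label_not_below B (j : nat) : (0 < j < label B)%N -> ~~ below_node B j.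
Proof.
rewrite /label; case: ifP => [_|]; last by lia.
move=> /andP[j0 jl].
have fm := find_size (below_node B) (iota 1 m.-1); rewrite size_iota in fm.
have := @before_find _ 0%N (below_node B) (iota 1 m.-1) j.-1.
by rewrite nth_iota ?add1n ?prednK //; [move=> -> //|]; lia.
Qed.

Lemma label_unique B (l : nat) : (0 < l <= m)%N -> near_nodes B ->
  (forall j, (0 < j < l)%N -> ~~ below_node B j) ->
  ((l < m)%N -> below_node B l) -> label B = l.
Proof.
move=> /andP[l0 lm] nB nl bl; have lab0 : (0 < label B)%N by rewrite label_gt0.
have := label_le B; case: (ltngtP (label B) l) => // ll labm.
  by have := nl (label B); rewrite label_below ?lab0 ?ll; [move/(_ isT)|lia].
by have := @label_not_below B l; rewrite l0 ll bl; [move/(_ isT)|lia].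
Qed.

Lemma node_dist B (z : R) (i j : nat) :
  `|node B i - node B j| <= z -> z < (hi B - lo B) / m%:R -> i = j.
Proof.
move=> ijz zw; apply/eqP; apply: contraTT (le_lt_trans ijz zw) => ij.
have w0 : 0 <= (hi B - lo B) / m%:R.
  by apply: ltW; apply: le_lt_trans zw; apply: le_trans ijz.
rewrite -leNgt /node [X in `|X|](_ : _ = (i%:R - j%:R) * ((hi B - lo B) / m%:R)); last ring.
rewrite normrM (ger0_norm w0) ler_peMl //.
rewrite -[i%:R]/(i%:Z%:~R) -[j%:R]/(j%:Z%:~R) -intrB -intr_norm ler1z.
by lia.
Qed.

(** Pigeonhole: the [m + 1] nodes are so far apart that the points chosen near them are distinct.
    They exhaust [B], which leaves one point per node. *)
Lemma near_nodes_uniq B (z b b' : R) (j : nat) :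
  (size (undup B) <= m.+1)%N -> B != [::] -> near_nodes B ->
  0 <= eta <= z -> 2 * z < (hi B - lo B) / m%:R -> (j <= m)%N ->
  b \in B -> `|b - node B j| <= z -> b' \in B -> `|b' - node B j| <= z -> b = b'.
Proof.
move=> sB B0 nB /andP[eta0 etaz] zw jm.
pose c i := nth 0 B (find (fun b => `|b - node B i| <= eta) B).
have hc i : (i <= m)%N -> has (fun b => `|b - node B i| <= eta) B.
  move=> im; have [i0|i0] := posnP i.
    by apply/hasP; exists (lo B); rewrite ?lo_mem// /node i0 !mul0r addr0 subrr normr0.
  have [ei|nei] := eqVneq i m.
    apply/hasP; exists (hi B); rewrite ?hi_mem// /node ei divff ?gt_eqF//.
    by rewrite mul1r [lo B + _]addrC subrK subrr normr0.
  by apply: (allP nB); rewrite mem_iota; lia.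
have cB i : (i <= m)%N -> c i \in B by move=> im; apply: mem_nth; rewrite -has_find hc.
have cn i : (i <= m)%N -> `|c i - node B i| <= eta by move=> im; have := nth_find 0 (hc i im).
have cu : uniq [seq c i | i <- iota 0 m.+1].
  rewrite map_inj_in_uniq ?iota_uniq // => i i'; rewrite !mem_iota !add0n !ltnS => /= im im' cc.
  apply: (node_dist B (2 * z)) => //.
  have := cn i im; have := cn i' im'; rewrite cc !ler_norml => /andP[? ?] /andP[? ?].
  by apply/andP; split; lra.
have cE : [seq c i | i <- iota 0 m.+1] =i undup B.
  apply: (uniq_min_size cu _ _).2; last by rewrite size_map size_iota.
  by move=> x /mapP[i]; rewrite mem_iota ltnS mem_undup => im ->; exact: cB.
have bc x : x \in B -> `|x - node B j| <= z -> x = c j.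
  rewrite -mem_undup -cE => /mapP[i]; rewrite mem_iota ltnS => /= im -> cz; congr c.
  apply: (node_dist B (2 * z)) => //.
  have := cn i im; move: cz; rewrite !ler_norml => /andP[? ?] /andP[? ?].
  by apply/andP; split; lra.
by move=> bB bz b'B b'z; rewrite (bc b) // (bc b').
Qed.

(** Some point is within [eta] of node [j], and by uniqueness it is [b]; below the node it would
    have made the label at most [j]. *)
Lemma label_gt_node B (z b : R) (j : nat) :
  (size (undup B) <= m.+1)%N -> B != [::] ->
  0 <= eta <= z -> 2 * z < (hi B - lo B) / m%:R -> (0 < j < label B)%N ->
  b \in B -> `|b - node B j| <= z -> node B j <= b.
Proof.
move=> sB B0 etaz zw jl bB bz.
have nB : near_nodes B by rewrite -label_gt0; lia.
have lm := label_le B.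
have /hasP[b0 b0B b0z] : has (fun b => `|b - node B j| <= eta) B.
  by apply: (allP nB); rewrite mem_iota; lia.
have -> : b = b0.
  apply: (near_nodes_uniq B z b b0 j) => //; first by case/andP: jl => _ /leq_trans/(_ lm)/ltnW.
  by apply: le_trans b0z _; case/andP: etaz.
have := label_not_below _ _ jl; apply: contraNT; rewrite -ltNge => bn.
apply/hasP; exists b0 => //; rewrite bn andbT.
by move: b0z; rewrite ler_norml => /andP[]; lra.
Qed.

(* [j / m] lies in [0, 1], so nodes are convex combinations of the extremes. *)
Lemma node_close B B' (e : R) (j : nat) : B != [::] -> B' != [::] ->
  (forall b, b \in B -> exists2 b', b' \in B' & `|b - b'| <= e) ->
  (forall b, b \in B' -> exists2 b', b' \in B & `|b - b'| <= e) ->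
  (j <= m)%N -> `|node B j - node B' j| <= e.
Proof.
move=> B0 B'0 BB' B'B jm; rewrite /node; set t := _ / _.
have t0 : 0 <= t by rewrite divr_ge0// ltW.
have t1 : t <= 1 by rewrite ler_pdivrMr// mul1r ler_nat.
have h1 := hi_close _ _ _ B0 B'0 BB'; have h2 := hi_close _ _ _ B'0 B0 B'B.
have h3 := lo_close _ _ _ B0 B'0 BB'; have h4 := lo_close _ _ _ B'0 B0 B'B.
by rewrite ler_norml; apply/andP; split; nra.
Qed.

(** A discrete intermediate value argument: the point near node [j] is below it in one set and not
    below it in another, so in all the sets it stays close to the node. *)
Lemma label_all_gt0 (B : nat -> seq R) (e : R) :
  0 <= e -> 4 * e <= eta ->
  (forall k, (k <= m)%N -> [/\ B k != [::], (size (undup (B k)) <= m.+1)%N &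
     2 * (eta + 2 * e) < (hi (B k) - lo (B k)) / m%:R]) ->
  (forall k k', (k <= m)%N -> (k' <= m)%N -> forall b, b \in B k ->
     exists2 b', b' \in B k' & `|b - b'| <= e) ->
  (forall j, (0 < j <= m)%N -> exists2 k, (k <= m)%N & label (B k) = j) ->
  forall k, (k <= m)%N -> (0 < label (B k))%N.
Proof.
move=> e0 eeta BP Bc Bl k km; rewrite label_gt0; apply/allP => j.
rewrite mem_iota add1n prednK // => /andP[j0 jm].
have [k1 k1m lk1] : exists2 k, (k <= m)%N & label (B k) = m.
  by apply: Bl; rewrite m_gt0 leqnn.
have [k2 k2m lk2] : exists2 k, (k <= m)%N & label (B k) = j.
  by apply: Bl; rewrite j0 ltnW.
have /hasP[b2 b2B /andP[b2l b2u]] : below_node (B k2) j.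
  by rewrite -[X in below_node _ X]lk2; apply: label_below; rewrite lk2 j0.
have [b1 b1B b12] := Bc _ _ k2m k1m _ b2B.
have [n0 s0 w0] := BP k km; have [n1 s1 w1] := BP k1 k1m; have [n2 s2 w2] := BP k2 k2m.
(* Points and nodes each move by at most [e] between two sets. Hence [b1] is less than [2 * e] above
   its node, and [b] is within [4 * e] of its own. *)
have := node_close _ _ e j n1 n2 (Bc _ _ k1m k2m) (Bc _ _ k2m k1m) (ltnW jm).
rewrite ler_norml => /andP[? ?].
have := node_close _ _ e j n1 n0 (Bc _ _ k1m km) (Bc _ _ km k1m) (ltnW jm).
rewrite ler_norml => /andP[? ?].
have [b bB bb1] := Bc _ _ k1m km _ b1B.
move: b12 bb1; rewrite !ler_norml => /andP[? ?] /andP[? ?].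
have : node (B k1) j <= b1.
  apply: (label_gt_node (B k1) (eta + 2 * e)) => //;
    [by apply/andP; split; lra|by rewrite lk1 j0|].
  by rewrite ler_norml; apply/andP; split; lra.
move=> ?; apply/hasP; exists b => //; rewrite ler_norml; apply/andP; split; lra.
Qed.

Lemma eq_hi B B' : B =i B' -> hi B = hi B'.
Proof.
move=> BB'; have [B0|B0] := eqVneq B [::]; have [B'0|B'0] := eqVneq B' [::].
- by rewrite B0 B'0.
- by have := hi_mem _ B'0; rewrite -BB' B0.
- by have := hi_mem _ B0; rewrite BB' B'0.
by apply/eqP; rewrite eq_le !le_hi // ?BB' ?hi_mem // -BB' hi_mem.
Qed.

Lemma eq_lo B B' : B =i B' -> lo B = lo B'.
Proof.
move=> BB'; have [B0|B0] := eqVneq B [::]; have [B'0|B'0] := eqVneq B' [::].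
- by rewrite B0 B'0.
- by have := lo_mem _ B'0; rewrite -BB' B0.
- by have := lo_mem _ B0; rewrite BB' B'0.
by apply/eqP; rewrite eq_le !lo_le // ?BB' ?lo_mem // -BB' lo_mem.
Qed.

Lemma eq_label B B' : B =i B' -> label B = label B'.
Proof.
move=> BB'.
have nE j : node B j = node B' j by rewrite /node (eq_hi _ _ BB') (eq_lo _ _ BB').
have -> : label B = if near_nodes B then (find (below_node B) (iota 1 m.-1)).+1 else 0 by [].
have -> : near_nodes B = near_nodes B'.
  by apply: eq_all => j; rewrite (eq_has_r BB'); apply: eq_has => b; rewrite nE.
congr (if _ then _.+1 else _); apply: eq_find => j.
by rewrite /below_node (eq_has_r BB'); apply: eq_has => b; rewrite nE.
Qed.

(** * Labels on the boundary: lattice sets, with nodes at the multiples of [K] *)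

Section Lattice.
Variable K : nat.
Hypotheses (eta1 : 1 <= eta) (etaK : 2 * (eta + 1) < K%:R).

Let K_gt0 : (0 < K)%N.
Proof. by rewrite -(@ltr0n R); move: eta1 etaK; lra. Qed.

Let eta_ltK : eta < K%:R.
Proof. by move: eta1 etaK; lra. Qed.

Definition lattice_set (z : seq nat) : seq R :=
  [seq i%:R | i <- [:: 0, m * K & z]%N].

Lemma hi_lattice z : all (geq (m * K)) z -> hi (lattice_set z) = (m * K)%:R.
Proof.
move=> /allP zN; apply/eqP; rewrite eq_le le_hi ?map_f ?inE ?eqxx ?orbT// andbT.
have /mapP[i iz ->] : hi (lattice_set z) \in lattice_set z by exact: hi_mem.
by rewrite ler_nat; move: iz; rewrite !inE => /or3P[/eqP->|/eqP->|/zN].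
Qed.

Lemma lo_lattice z : lo (lattice_set z) = 0.
Proof.
apply/eqP; rewrite eq_le (lo_le _ 0) ?inE ?eqxx//=.
have /mapP[i iz ->] : lo (lattice_set z) \in lattice_set z by exact: lo_mem.
by rewrite ler0n.
Qed.

Lemma node_lattice z j : all (geq (m * K)) z ->
  node (lattice_set z) j = (j * K)%:R.
Proof.
move=> zN; rewrite /node lo_lattice hi_lattice // subr0 add0r !natrM.
by field; rewrite gt_eqF.
Qed.

(** The first [k] letters have been raised onto their nodes and the others are still one unit below,
    so node [k + 1] is the first with a point just below it. *)
Lemma label_lattice_nodes (k : nat) : (k < m)%N ->
  label (lattice_set (vert k [seq (i.+1 * K).-1 | i <- iota 0 m.-1])) = k.+1.
Proof.
move=> km; set z := map _ _.
have zK i : (i < m.-1)%N -> nth 0%N z i = (i.+1 * K).-1.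
  by move=> im; rewrite (nth_map 0%N) ?size_iota // nth_iota.
have sz : size z = m.-1 by rewrite size_map size_iota.
have vK i : (i < m.-1)%N -> nth 0%N (vert k z) i = ((i.+1 * K).-1 + (i < k))%N.
  by move=> im; rewrite nth_vert ?sz // zK.
have zN : all (geq (m * K)) (vert k z).
  apply/(all_nthP 0%N) => i; rewrite size_vert sz => im; rewrite vK //=.
  by nia.
have nd j := node_lattice (vert k z) j zN.
apply: label_unique; first by lia.
- apply/allP => j; rewrite mem_iota => jm; apply/hasP.
  have jm1 : (j.-1 < m.-1)%N by lia.
  exists (nth 0%N (vert k z) j.-1)%:R.
    by rewrite map_f // !inE mem_nth ?orbT // size_vert sz.
  rewrite nd vK // prednK; last by lia.
  apply: le_trans eta1; rewrite distrC ger0_norm ?subr_ge0 ?ler_nat; last by nia.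
  by rewrite lerBlDr nat1r ler_nat; nia.
- move=> j /andP[j0 jk]; apply/hasPn => x /mapP[i iz ->]; rewrite nd.
  apply/negP => /andP[]; rewrite ltr_nat lerBlDr => jlo jhi.
  (* As [eta < K], the point would lie strictly between nodes [j - 1] and [j]. *)
  have jlo' : ((j * K)%N < i + K)%N.
    by rewrite -(ltr_nat R) natrD; apply: le_lt_trans jlo _; rewrite ltrD2l.
  move: iz; rewrite !inE => /or3P[/eqP i0|/eqP iN|/(nthP 0%N)[p]].
  + by nia.
  + by nia.
  rewrite size_vert sz => pm; rewrite vK // => pi.
  have pj : p.+1 = j by nia.
  by nia.
move=> km1; apply/hasP; exists (nth 0%N (vert k z) k)%:R.
  by rewrite map_f // !inE mem_nth ?orbT // size_vert sz; lia.
rewrite nd vK; last by lia.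
rewrite ltnn addn0 ltr_nat; apply/andP; split; last by nia.
rewrite lerBlDr; apply: (@le_trans _ _ ((k.+1 * K).-1%:R + 1)).
  by rewrite natr1 prednK //; nia.
by rewrite lerD2l.
Qed.

(** The boundary map has degree one: exactly one word is rainbow. Only [m] steps are available for
    [m] labels, and each increase of the label raises a letter across a node, which determines the
    letters. *)
Lemma label_lattice_unique (z : seq nat) : size z = m.-1 ->
  all (gtn (m * K)) z ->
  perm_eq [seq label (lattice_set (vert j z)) | j <- iota 0 m] (iota 1 m) =
  (z == [seq (i.+1 * K).-1 | i <- iota 0 m.-1]).
Proof.
move=> sz zN; apply/idP/eqP => [pz|->]; last first.
  rewrite (iotaDl 1 0); apply/permP => P; congr count; apply/eq_in_map => k.
  by rewrite mem_iota; exact: label_lattice_nodes.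
have lm j : (0 < j <= m)%N -> exists2 k, (k < m)%N & label (lattice_set (vert k z)) = j.
  move=> jm; have : j \in iota 1 m by rewrite mem_iota add1n ltnS.
  by rewrite -(perm_mem pz) => /mapP[k]; rewrite mem_iota => km ->; exists k.
have vN k := all_vert k _ _ zN.
have nd k j := node_lattice (vert k z) j (vN k).
have sB k : (size (undup (lattice_set (vert k z))) <= m.+1)%N.
  by apply: leq_trans (size_undup _) _; rewrite size_map /= size_vert sz; lia.
have wB k : 2 * (eta + 1) < (hi (lattice_set (vert k z)) - lo (lattice_set (vert k z))) / m%:R.
  by rewrite hi_lattice // lo_lattice subr0 natrM mulrAC divff ?mul1r // gt_eqF.
(* If label [j] is attained at step [k] and a larger one at step [k'], then the
   letter that crosses the [j]th node is incremented between these steps. *)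
have step j l k k' : (0 < j < l)%N -> (l <= m)%N ->
    label (lattice_set (vert k z)) = j -> label (lattice_set (vert k' z)) = l ->
    exists2 i, (i < m.-1)%N & (k <= i < k')%N /\ nth 0%N z i = (j * K).-1.
  move=> jl lm' labk labk'.
  have /hasP[b bB] : below_node (lattice_set (vert k z)) j.
    by rewrite -[X in below_node _ X]labk; apply: label_below; lia.
  rewrite nd; case/mapP: bB => v + ->; rewrite ltr_nat lerBlDr => vz /andP[vl vu].
  have vl' : ((j * K)%N < v + K)%N.
    by rewrite -(ltr_nat R) natrD; apply: le_lt_trans vl _; rewrite ltrD2l.
  move: vz; rewrite !inE => /or3P[/eqP v0|/eqP vN'|]; [by nia|by nia|].
  move=> /(nthP 0%N)[i]; rewrite size_vert sz => im; rewrite nth_vert ?sz // => iv.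
  exists i => //.
  have : ((j * K)%:R : R) <= (nth 0%N z i + (i < k'))%:R.
    rewrite -(nd k'); apply: (label_gt_node _ (eta + 1)) => //;
      [by apply/andP; split; move: eta1; lra|by rewrite labk'| |].
      by rewrite map_f // -nth_vert ?sz // !inE mem_nth ?orbT // size_vert sz.
    rewrite nd ler_norml.
    have : ((nth 0%N z i + (i < k'))%:R : R) <= v%:R + 1 by rewrite natr1 ler_nat; lia.
    have : (v%:R : R) <= (nth 0%N z i + (i < k'))%:R + 1 by rewrite natr1 ler_nat; lia.
    have : (v%:R : R) <= (j * K)%:R by rewrite ler_nat ltnW.
    by move=> ? ? ?; apply/andP; split; lra.
  by rewrite ler_nat; lia.
(* By [step], labels increase strictly with the step number; with [upper], label [j] occurs exactly
   at step [j - 1]. *)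
have lower j : (0 < j <= m)%N -> forall k, (k < m)%N ->
    label (lattice_set (vert k z)) = j -> (j.-1 <= k)%N.
  elim: j => // j IH jm k km labk; have [->//|j0] := posnP j.
  have [|k' k'm labk'] := lm j; first by lia.
  have jk' : (j.-1 <= k')%N by apply: IH labk' => //; lia.
  by have [||i _ []] := step j j.+1 k' k _ _ labk' labk; lia.
have upper d j : (0 < j)%N -> (j + d = m)%N -> forall k, (k < m)%N ->
    label (lattice_set (vert k z)) = j -> (k <= j.-1)%N.
  elim: d j => [|d IH] j j0 jd k km labk; first by lia.
  have [|k' k'm labk'] := lm j.+1; first by lia.
  have jk' : (k' <= j)%N by apply: (IH j.+1) labk' => //; lia.
  by have [||i _ []] := step j j.+1 k k' _ _ labk labk'; lia.
apply: (@eq_from_nth _ 0%N); first by rewrite size_map size_iota.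
move=> i; rewrite sz => im; rewrite (nth_map 0%N) ?size_iota // nth_iota // add0n.
have [|k km labk] := lm i.+1; first by lia.
have [|k' km' labk'] := lm i.+2; first by lia.
have l1 : (i <= k)%N by apply: (lower i.+1) labk => //; lia.
have u2 : (k' <= i.+1)%N by apply: (upper (m - i.+2)%N i.+2) labk' => //; lia.
have [||i' _ [ikk <-]] := step i.+1 i.+2 k k' _ _ labk labk'; [lia|lia|].
by congr nth; lia.
Qed.

End Lattice.
End Labels.

Arguments hi {R} B.
Arguments lo {R} B.
Arguments label {R} m eta B.
Arguments lattice_set {R} m K z.

(** * The retraction restricted to a geodesic *)

(** Sorting leaves [m + 1] consecutive gaps inside an interval of length [N]. *)
Lemma close_pair (m N : nat) (s : seq nat) : size s = m.+2 -> all (geq N) s ->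
  exists p q t, [/\ perm_eq s [:: p, q & t], (p <= q)%N & ((q - p) * m.+1 <= N)%N].
Proof.
move=> ss sN; pose t := sort leq s.
have st : size t = m.+2 by rewrite size_sort.
have ts : sorted leq t by apply: sort_sorted; exact: leq_total.
have [/hasP[i]|/hasPn nt] :=
    boolP (has (fun i => (nth 0 t i.+1 - nth 0 t i) * m.+1 <= N)%N (iota 0 m.+1)).
  rewrite mem_iota add0n => /= im ti.
  exists (nth 0%N t i), (nth 0%N t i.+1), (take i t ++ drop i.+2 t); split => //.
    rewrite -(perm_sort leq) -/t -{1}(cat_take_drop i t).
    rewrite (drop_nth 0%N) ?st; last by lia.
    rewrite (drop_nth 0%N) ?st; last by lia.
    by rewrite (perm_catCA _ [:: _; _]).
  by apply: (sorted_leq_nth leq_trans leqnn) => //; rewrite inE st; lia.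
(* If all gaps were larger, the last entry would exceed [N]; the summand [(0 < i)] keeps the
   inequality strict. *)
have step i : (i <= m.+1)%N -> (i * N + (0 < i) <= nth 0 t i * m.+1)%N.
  elim: i => // i IH im; have := nt i; rewrite mem_iota add0n im => /(_ isT).
  by have := IH (ltnW im); nia.
have := step m.+1 (leqnn _).
have : (nth 0 t m.+1 <= N)%N.
  by apply: (allP sN); rewrite -(mem_sort leq) mem_nth // st.
by nia.
Qed.

Section Retraction.
Variables (R : realType) (X : metricType R).
Variables (m K : nat) (e : bool) (lam L : R) (g : R -> X).
Variable r : {fset X} -> {fset X}.

Let N := (m * K)%N.
Let n := (m + 2 + e)%N.
Let theta : R := (L + 1) / (2 * m.+1%:R).

Hypotheses (m_gt0 : (0 < m)%N) (m_even : ~~ odd m).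
Hypotheses (lam_gt0 : 0 < lam) (L_ge0 : 0 <= L) (L_lt : L < m%:R).
(** Nodes of a profile will be at least [K * (1 - 2 * theta)] apart. The labels need
    [2 * (eta + 2 * e)] with [e = L + 1] and [eta = 4 * e], whence the factor [12]. *)
Hypothesis K_large : 12 * (L + 1) < K%:R * (1 - 2 * theta).
Hypothesis g_iso : forall s t, 0 <= s <= 2 * N%:R -> 0 <= t <= 2 * N%:R ->
  mdist (g s) (g t) = lam * `|s - t|.
Hypothesis r_lip : forall A B : {fset X}, A != fset0 -> B != fset0 ->
  (#|` A| <= n)%N -> (#|` B| <= n)%N -> hdist (r A) (r B) <= L * hdist A B.
Hypothesis r_id : forall A : {fset X}, A != fset0 -> (#|` A| <= n.-1)%N -> r A = A.
Hypothesis r_card : forall A : {fset X}, A != fset0 -> (#|` A| <= n)%N ->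
  r A != fset0 /\ (#|` r A| <= n.-1)%N.

(** * Heights and configurations along the geodesic *)

Let in_range (t : R) : bool := 0 <= t <= 2 * N%:R.

Let height (x : X) : R := mdist x (g 0) / lam.

Let height_g t : in_range t -> height (g t) = t.
Proof.
move=> tN; rewrite /height g_iso //; last first.
  by rewrite lexx mulr_ge0.
by rewrite subr0 ger0_norm 1?mulrC ?mulKf ?gt_eqF//; case/andP: tN.
Qed.

Let height_lip x y c : mdist x y <= lam * c -> `|height x - height y| <= c.
Proof.
move=> xyc; rewrite /height -mulrBl normrM (gtr0_norm (x := lam^-1)) ?invr_gt0//.
rewrite ler_pdivrMr // [c * _]mulrC; apply: le_trans xyc.
have := metric_triangle x y (g 0); have := metric_triangle y x (g 0).
rewrite (metric_sym y x) ler_norml => ? ?; apply/andP; split; lra.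
Qed.

Let image (l : seq R) : {fset X} := [fset x in [seq g t | t <- l]]%fset.

Let in_image x l : (x \in image l) = (x \in [seq g t | t <- l]).
Proof. by rewrite inE. Qed.

Let image_neq0 l : l != [::] -> image l != fset0.
Proof.
case: l => // t l _; apply/fset0Pn; exists (g t).
by rewrite in_image mem_head.
Qed.

Let card_image l : (#|` image l| <= size l)%N.
Proof. by rewrite card_fseq; apply: leq_trans (size_undup _) _; rewrite size_map. Qed.

Let matched (l l' : seq R) (c : R) :=
  forall a, a \in l -> exists2 b, b \in l' & `|a - b| <= c.

Let hdist_image l l' c : l != [::] -> l' != [::] ->
  all in_range l -> all in_range l' -> matched l l' c -> matched l' l c ->
  hdist (image l) (image l') <= lam * c.
Proof.
move=> l0 l'0 /allP lr /allP l'r ll' l'l.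
apply/hdist_le; rewrite ?image_neq0 //.
split=> x; rewrite in_image => /mapP[t tl ->].
  have [b bl tb] := ll' _ tl; exists (g b); first by rewrite in_image map_f.
  by rewrite g_iso ?ler_pM2l //; [exact: lr|exact: l'r].
have [b bl tb] := l'l _ tl; exists (g b); first by rewrite in_image map_f.
by rewrite g_iso ?ler_pM2l //; [exact: l'r|exact: lr].
Qed.

(** For odd [n], the far point uses up one point of the cardinality bound, so that [m] can stay
    even. *)
Let extra : seq R := if e then [:: 2 * N%:R] else [::].
Let points (s : seq nat) : seq R := [seq i%:R | i <- [:: 0, N & s]%N] ++ extra.
Let config (s : seq nat) : {fset X} := r (image (points s)).
(* The cutoff removes the points close to [2 * N]. *)
Let profile (s : seq nat) : seq R :=
  [seq b <- [seq height x | x <- config s] | b < 3 / 2 * N%:R].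

(** Here [L < m] enters: [2 * theta] is [(L + 1) / (m + 1)]. *)
Let theta_lt : 2 * theta < 1.
Proof.
rewrite /theta -natr1; have m1 : 0 < m%:R + 1 :> R by rewrite natr1.
rewrite mulrA ltr_pdivrMr; last by lra.
by move: L_lt; lra.
Qed.

Let theta_gt0 : 0 < theta.
Proof. by rewrite divr_gt0 ?mulr_gt0 // ltr_wpDl. Qed.

Let d : R := N%:R * theta.

Let N_large : 12 * (L + 1) < N%:R - 2 * d.
Proof.
have : 1 <= m%:R :> R by rewrite ler1n.
have : N%:R = m%:R * K%:R :> R by rewrite /N natrM.
rewrite /d => -> m1; have K0 : 0 <= K%:R * (1 - 2 * theta).
  by rewrite mulr_ge0 // subr_ge0 ltW.
apply: (lt_le_trans K_large).
rewrite [leRHS](_ : _ = m%:R * (K%:R * (1 - 2 * theta))); last by ring.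
by rewrite ler_peMl.
Qed.

Let d_gt0 : 0 < d.
Proof.
rewrite /d mulr_gt0 // ltr0n /N muln_gt0 m_gt0 -(ltr0n R).
have := K_large; have := theta_lt; have := L_ge0; have := ler0n R K.
rewrite le_eqVlt => /predU1P[<-|//]; rewrite mul0r; lra.
Qed.

Let N_gt0 : 0 < N%:R :> R.
Proof. by move: N_large d_gt0 L_ge0; lra. Qed.

Let points_neq0 s : points s != [::].
Proof. by []. Qed.

Let size_points s : size (points s) = (size s + 2 + e)%N.
Proof. by rewrite size_cat size_map /extra /=; case: (e); rewrite /= addn2. Qed.

Let extra_range : all in_range extra.
Proof. by rewrite /extra; case: (e) => //=; rewrite /in_range lexx andbT mulr_ge0. Qed.

Let nat_range i : (i <= N)%N -> in_range i%:R.
Proof.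
rewrite /in_range ler0n -(ler_nat R) /= => iN.
by move: N_gt0; lra.
Qed.

Let points_range s : all (geq N) s -> all in_range (points s).
Proof.
move=> /allP sN; rewrite all_cat extra_range andbT all_map.
apply/allP => i; rewrite !inE => /or3P[/eqP->|/eqP->|/sN]; exact: nat_range.
Qed.

Let card_points s : (size s <= m)%N -> (#|` image (points s)| <= n)%N.
Proof.
by move=> sm; apply: leq_trans (card_image _) _; rewrite size_points /n !leq_add2r.
Qed.

(** The list [l] is arbitrary so as to serve both for merging two points and for passing to another
    vertex of a simplex. *)
Let config_close s l c : (size s <= m)%N -> all (geq N) s ->
  l != [::] -> (size l <= n)%N -> all in_range l ->
  matched (points s) l c -> matched l (points s) c ->
  (forall x, x \in config s ->
     exists2 y, y \in r (image l) & `|height x - height y| <= L * c) /\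
  (forall y, y \in r (image l) ->
     exists2 x, x \in config s & `|height y - height x| <= L * c).
Proof.
move=> sm sN l0 ln lr sl ls.
have cp := card_points _ sm; have cl := leq_trans (card_image l) ln.
have p0 := image_neq0 _ (points_neq0 s); have il0 := image_neq0 _ l0.
have := hdist_image _ _ _ (points_neq0 s) l0 (points_range _ sN) lr sl ls.
move=> /(ler_wpM2l L_ge0)/(le_trans (r_lip _ _ p0 il0 cp cl)).
rewrite mulrCA => /hdist_le[]; [exact: (r_card _ p0 cp).1|exact: (r_card _ il0 cl).1|].
move=> h1 h2; split=> x xin.
  by have [y yin xy] := h1 x xin; exists y => //; exact: height_lip.
by have [y yin xy] := h2 x xin; exists y => //; exact: height_lip.
Qed.

(* Merging the two closest points of [points s] into their midpoint moves it
   by at most [N / (2 (m + 1))] and lands where [r] is the identity. *)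
Let displacement s : size s = m -> all (geq N) s ->
  matched [seq height x | x <- config s] (points s) d /\
  matched (points s) [seq height x | x <- config s] d.
Proof.
move=> sm sN.
have [p [q [t [pq lepq qp]]]] : exists p q t, [/\ perm_eq [:: 0, N & s]%N [:: p, q & t],
    (p <= q)%N & ((q - p) * m.+1 <= N)%N].
  by apply: close_pair; rewrite /= ?sm // leqnn.
have N_all : all (geq N) [:: p, q & t].
  by rewrite -(perm_all _ pq) /= leqnn.
pose c : R := N%:R / (2 * m.+1%:R).
have m1 : 0 < m.+1%:R :> R by rewrite ltr0n.
have c0 : 0 <= c by rewrite divr_ge0 ?mulr_ge0.
(* One [c] for the merging itself, and [L * c] for its effect on the image. *)
have dE : d = L * c + c by rewrite /d /theta /c; field; rewrite gt_eqF.
have qpc : (q%:R - p%:R) / 2 <= c :> R.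
  rewrite /c -natrB // ler_pdivrMr // mulrAC.
  rewrite [X in _ <= X](_ : _ = N%:R / m.+1%:R); last by field; rewrite gt_eqF.
  by rewrite ler_pdivlMr // -natrM ler_nat.
have qp0 : (p%:R : R) <= q%:R by rewrite ler_nat.
pose l : seq R := (p%:R + q%:R) / 2 :: [seq i%:R | i <- t] ++ extra.
have st : size t = m by have := perm_size pq; rewrite /= sm => -[].
have sl : size l = n.-1.
  by rewrite /= size_cat size_map st /extra /n; case: (e); rewrite /= addn2 ?addn0 ?addn1.
have pr : in_range p%:R by apply: nat_range; case/and3P: N_all.
have qr : in_range q%:R by apply: nat_range; case/and3P: N_all.
have lr : all in_range l.
  rewrite /= all_cat extra_range andbT; apply/andP; split.
    by move: pr qr; rewrite /in_range => /andP[? ?] /andP[? ?]; apply/andP; split; lra.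
  rewrite all_map; apply/allP => i it; apply: nat_range.
  by case/and3P: N_all => _ _ /allP; apply.
have memp x : (x \in points s) = (x \in [seq i%:R | i <- [:: p, q & t]%N] ++ extra).
  by rewrite !mem_cat; congr orb; apply: perm_mem; exact: perm_map.
have ptl : matched (points s) l c.
  move=> a; rewrite memp /= !inE => /or3P[/eqP->|/eqP->|al].
  - exists ((p%:R + q%:R) / 2); rewrite ?mem_head// ler_norml.
    by apply/andP; split; lra.
  - exists ((p%:R + q%:R) / 2); rewrite ?mem_head// ler_norml.
    by apply/andP; split; lra.
  by exists a; rewrite ?subrr ?normr0 // inE al orbT.
have ltp : matched l (points s) c.
  move=> a; rewrite inE => /predU1P[->|al].
    exists p%:R; first by rewrite memp mem_head.
    by rewrite ler_norml; apply/andP; split; lra.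
  by exists a; rewrite ?subrr ?normr0 // memp /= !inE al !orbT.
have il : r (image l) = image l.
  by apply: r_id; rewrite ?image_neq0 // -sl; exact: card_image.
have sln : (size l <= n)%N by rewrite sl; exact: leq_pred.
have [h1 h2] := config_close s l c (eq_leq sm) sN isT sln lr ptl ltp.
rewrite il in h1 h2; split.
  move=> _ /mapP[x xc ->]; have [y] := h1 x xc.
  rewrite in_image => /mapP[a al ->]; rewrite height_g ?(allP lr) // => xa.
  have [b bp ab] := ltp _ al; exists b => //.
  move: xa ab; rewrite dE !ler_norml => /andP[? ?] /andP[? ?].
  by apply/andP; split; lra.
move=> a ap; have [b bl ab] := ptl _ ap.
have [|x xc xb] := h2 (g b); first by rewrite in_image map_f.
exists (height x); first by rewrite map_f.
move: xb ab; rewrite height_g ?(allP lr) // dE !ler_norml => /andP[? ?] /andP[? ?].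
by apply/andP; split; lra.
Qed.

(** An image point near [2 * N] has height at least [2 * N - d], which is beyond the cutoff since
    [2 * d < N]. *)
Let profile_le s b : size s = m -> all (geq N) s -> b \in profile s -> b <= N%:R + d.
Proof.
move=> sm sN; rewrite mem_filter => /andP[bN bc].
have [a ap] := (displacement s sm sN).1 b bc.
rewrite ler_norml => /andP[bl ba]; move: ap; rewrite mem_cat => /orP[/mapP[i]|].
  move=> iN aE; have : a <= N%:R.
    by rewrite aE ler_nat; move: iN; rewrite !inE => /or3P[/eqP->|/eqP->|/(allP sN)].
  by lra.
rewrite /extra; case: (e) => //; rewrite inE => /eqP aE.
by move: N_large L_ge0; rewrite aE in bl; lra.
Qed.

Let profile_near s (i : nat) : size s = m -> all (geq N) s -> i \in [:: 0; N]%N ->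
  exists2 b, b \in profile s & `|i%:R - b| <= d.
Proof.
move=> sm sN iN; have [|b bc ib] := (displacement s sm sN).2 i%:R.
  by rewrite mem_cat map_f //; move: iN; rewrite !inE => /orP[] ->; rewrite ?orbT.
exists b => //; rewrite mem_filter bc andbT.
have : (i%:R : R) <= N%:R by rewrite ler_nat; move: iN; rewrite !inE => /orP[] /eqP ->.
by move: ib N_large L_ge0; rewrite ler_norml => /andP[]; lra.
Qed.

(** Points near [0] and [N] survive the cutoff, which gives the width. The image has at most
    [m + 1 + e] points, and if [e] holds one of them is near [2 * N] and is cut off. *)
Let profile_spec s : size s = m -> all (geq N) s ->
  [/\ profile s != [::], (size (undup (profile s)) <= m.+1)%N &
   N%:R - 2 * d <= hi (profile s) - lo (profile s)].
Proof.
move=> sm sN.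
have [b0 b0P] := profile_near s 0 sm sN isT; rewrite ler_norml => /andP[? ?].
have [|b1 b1P] := profile_near s N sm sN; first by rewrite !inE eqxx orbT.
rewrite ler_norml => /andP[? ?].
split; [by case: (profile s) b0P| |]; last first.
  by have := le_hi _ _ _ b1P; have := lo_le _ _ _ b0P; lra.
apply: leq_trans (size_undup _) _; rewrite /profile size_filter.
have [_] := r_card _ (image_neq0 _ (points_neq0 s)) (card_points _ (eq_leq sm)).
rewrite -/(config s) => cs.
have sc : (size [seq height x | x <- config s] <= n.-1)%N by rewrite size_map.
case E: e; last by apply: leq_trans (count_size _ _) _; move: sc; rewrite /n E addn0 addn2.
have [|b bc nb] := (displacement s sm sN).2 (2 * N%:R).
  by rewrite mem_cat /extra E mem_head orbT.
set a := (X in count X _); set h := (X in count _ X).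
have cah : (0 < count (predC a) h)%N.
  rewrite -has_count; apply/hasP; exists b => //=; rewrite -leNgt.
  by move: nb N_large L_ge0; rewrite ler_norml => /andP[]; lra.
move: sc cah (count_predC a h); rewrite /n E -/h.
by move: (count a h) (count _ h) (size h); clear; lia.
Qed.

(** The repeated [0] leaves at most [n - 1] points, so [r] fixes the set. *)
Let profile_face z : (size z <= m.-1)%N -> all (geq N) z ->
  profile (0%N :: z) =i (lattice_set m K z : seq R).
Proof.
move=> zm zN; have z0N : all (geq N) (0%N :: z) by [].
have iE : image (points (0%N :: z)) = image (points z).
  apply/fsetP => x; rewrite !in_image; apply: eq_mem_map => t.
  by rewrite /= !inE; case: (t == 0); rewrite /= ?orbT.
have cE : config (0%N :: z) = image (points (0%N :: z)).
  apply: r_id; first exact: image_neq0.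
  rewrite iE; apply: leq_trans (card_image _) _; rewrite size_points /n.
  by move: zm m_gt0; clear; lia.
have pr := points_range _ z0N.
have lE : (lattice_set m K z : seq R) =i [seq i%:R | i <- [:: 0, N, 0 & z]%N].
  by move=> x; rewrite /lattice_set /= !inE; case: (x == 0); rewrite /= ?orbT.
move=> x; rewrite lE mem_filter cE; apply/andP/idP => [[xN /mapP[y]]|xl].
  rewrite in_image => /mapP[t tp ->] xE; move: xE xN; rewrite height_g ?(allP pr) // => -> tN.
  move: tp; rewrite mem_cat => /orP[//|]; rewrite /extra; case: (e) => //.
  by rewrite inE => /eqP tE; move: tN N_gt0; rewrite tE; lra.
have xp : x \in points (0%N :: z) by rewrite mem_cat xl.
split; last first.
  apply/mapP; exists (g x); last by rewrite height_g // (allP pr).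
  by rewrite in_image map_f.
case/mapP: xl => i iz ->.
have : (i%:R : R) <= N%:R.
  by rewrite ler_nat; move: iz; rewrite !inE => /or4P[/eqP->|/eqP->|/eqP->|/(allP zN)].
by move: N_gt0; lra.
Qed.

Let vert_matched y k k' : matched (points (vert k y)) (points (vert k' y)) 1.
Proof.
move=> a; rewrite mem_cat => /orP[/mapP[i + ->]|ae]; last first.
  by exists a; rewrite ?subrr ?normr0 // mem_cat ae orbT.
rewrite !inE => /or3P[/eqP->|/eqP->|/(nthP 0%N)[j jy <-]].
- by exists 0; rewrite ?subrr ?normr0 // mem_cat mem_head.
- by exists N%:R; rewrite ?subrr ?normr0 // mem_cat !inE eqxx orbT.
rewrite size_vert in jy; exists (nth 0%N (vert k' y) j)%:R.
  by rewrite mem_cat map_f // !inE mem_nth ?orbT // size_vert.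
rewrite !nth_vert // !natrD opprD addrACA subrr add0r.
by case: (j < k)%N; case: (j < k')%N;
  rewrite ?subrr ?subr0 ?sub0r ?normrN ?normr1 ?normr0.
Qed.

(** A point of height at most [N + d] cannot cross the cutoff by moving at most [L]. *)
Let profile_close y k k' b : size y = m -> all (gtn N) y -> b \in profile (vert k y) ->
  exists2 b', b' \in profile (vert k' y) & `|b - b'| <= L + 1.
Proof.
move=> ym yN bP; have kN j := all_vert j _ _ yN.
have ks j : size (vert j y) = m by rewrite size_vert.
have bN := profile_le _ _ (ks k) (kN k) bP.
move: bP; rewrite mem_filter => /andP[_ /mapP[x xc bE]].
have [] := config_close (vert k y) (points (vert k' y)) 1 (eq_leq (ks k)) (kN k)
  (points_neq0 _) _ (points_range _ (kN k')) (vert_matched _ _ _) (vert_matched _ _ _).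
  by rewrite size_points ks.
move=> /(_ x xc)[x' x'c]; rewrite mulr1 -bE => xx' _.
exists (height x'); last by apply: le_trans xx' _; rewrite lerDl.
rewrite mem_filter map_f // andbT.
by move: xx' bN N_large d_gt0 L_ge0; rewrite ler_norml => /andP[]; lra.
Qed.

Let profile_eq s1 s2 : [:: 0, N & s1]%N =i [:: 0, N & s2]%N -> profile s1 = profile s2.
Proof.
move=> s12; rewrite /profile /config; congr [seq b <- [seq _ | x <- r _] | _].
apply/fsetP => x; rewrite !in_image; apply: eq_mem_map => t.
by rewrite !mem_cat (eq_mem_map _ s12).
Qed.

(** [sperner_words] yields a simplex with all the labels [1, ..., m] and also the label [0], which
    [label_all_gt0] forbids. *)
Lemma retraction_contra : False.
Proof.
pose eta := 4 * (L + 1); pose lab s := label m eta (profile s).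
have eta1 : 1 <= eta by move: L_ge0; rewrite /eta; lra.
have etaK : 2 * (eta + 1) < K%:R.
  have : K%:R * (1 - 2 * theta) <= K%:R.
    by rewrite ler_piMr // lerBlDr lerDl mulr_ge0 // ltW.
  by move: K_large L_ge0; rewrite /eta; lra.
have K_gt0 : (0 < K)%N by rewrite -(ltr0n R); move: eta1 etaK; lra.
have labE s1 s2 : [:: 0, N & s1]%N =i [:: 0, N & s2]%N -> lab s1 = lab s2.
  by move=> s12; rewrite /lab (profile_eq _ _ s12).
have face_odd : wsum N m.-1 (face lab m).
  apply: (wsum_pred1 _ _ _ [seq (i.+1 * K).-1 | i <- iota 0 m.-1]%N).
  - by rewrite size_map size_iota.
  - rewrite all_map; apply/allP => i; rewrite mem_iota /N /= => im.
    by move: im K_gt0 m_gt0; clear; nia.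
  move=> z zm zN; rewrite -(label_lattice_unique _ _ _ m_gt0 _ eta1 etaK) //.
  congr perm_eq; apply/eq_map => j; apply: eq_label.
  by apply: profile_face; [rewrite size_vert zm|exact: all_vert].
have [y [ym yN labs [k km]]] := sperner_words _ _ labE _ m_gt0 m_even face_odd.
rewrite /lab (label_le _ _ _ m_gt0) andbT => /negP; apply.
have vN j := all_vert j _ _ yN.
have vm j : size (vert j y) = m by rewrite size_vert.
apply: (label_all_gt0 _ _ _ m_gt0 (fun k => profile (vert k y)) (L + 1)) km => //.
- by rewrite addr_ge0.
- move=> j _; have [p0 ps pw] := profile_spec _ (vm j) (vN j); split => //.
  apply: (@lt_le_trans _ _ ((N%:R - 2 * d) / m%:R)); last first.
    by rewrite ler_pM2r // invr_gt0 ltr0n.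
  have m0 : (m%:R : R) != 0 by rewrite pnatr_eq0 -lt0n.
  have -> : (N%:R - 2 * d) / m%:R = K%:R * (1 - 2 * theta).
    by rewrite /d /N natrM; field.
  by move: K_large; rewrite /eta; lra.
by move=> j j' _ _ b; exact: profile_close.
Qed.

End Retraction.

(** * The lower bound from a single nonconstant geodesic *)

Lemma geodesic_Lip_ge (R : realType) (X : metricType R) (g : R -> X) (lam : R)
    (n : nat) (r : finsub X n -> finsub X n.-1) :
  0 < lam ->
  (forall s t, 0 <= s <= 1 -> 0 <= t <= 1 -> mdist (g s) (g t) = lam * `|s - t|) ->
  (2 <= n)%N -> lipschitz_retraction (finsub_incl (leq_pred n)) r ->
  n%:R - 3 <= Lip r.
Proof.
move=> lam0 gE n2 [/Lip_least[[L0 rL] _] rK]; set L := Lip r in L0 rL *.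
rewrite leNgt; apply/negP => Ln.
have n4 : (3 < n)%N by rewrite -(ltr_nat R); lra.
have [m [e [nE m0 mo]]] : exists m (e : bool), [/\ n = (m + 2 + e)%N, (0 < m)%N & ~~ odd m].
  (* So [m] is [n - 2] or [n - 3], and in both cases [L < n - 3 <= m]. *)
  exists n./2.-1.*2, (odd n); rewrite odd_double.
  by have := odd_double_half n; move: (n./2) n4; clear; case: odd => h; split=> //; lia.
have Lm : L < m%:R.
  apply: (lt_le_trans Ln); rewrite lerBlDr -natrD ler_nat nE; case: (e); lia.
pose theta : R := (L + 1) / (2 * m.+1%:R).
have theta_lt : 2 * theta < 1.
  rewrite /theta mulrA ltr_pdivrMr ?mulr_gt0 ?ltr0n // -natr1.
  by move: Lm; lra.
pose q : R := 12 * (L + 1) / (1 - 2 * theta); pose K := Num.bound q.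
have q0 : 0 <= q by rewrite divr_ge0 ?subr_ge0 ?(ltW theta_lt) // mulr_ge0 // addr_ge0.
have KP : 12 * (L + 1) < K%:R * (1 - 2 * theta).
  by rewrite -ltr_pdivrMr ?subr_gt0 //; exact: archi_boundP.
have K0 : (0 < K)%N by rewrite -(ltr0n R); apply: le_lt_trans q0 (archi_boundP q0).
have N0 : 0 < 2 * (m * K)%:R :> R by rewrite mulr_gt0 // ltr0n muln_gt0 m0.
(* A singleton serves as the default value that extends [r] to all finite sets; sets of admissible
   size never meet it. *)
have A0P : let A := [fset g 0]%fset in (A != fset0) && (#|` A| <= n)%N.
  by move=> A; rewrite -cardfs_gt0 cardfs1 (leq_trans _ n2).
pose r' (A : {fset X}) : {fset X} := r (insubd (FinSub A0P) A).
have insub_val (A : {fset X}) : A != fset0 -> (#|` A| <= n)%N ->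
    (insubd (FinSub A0P) A : {fset X}) = A.
  by move=> A0 An; apply: (insubdK (FinSub A0P)); apply/andP.
apply: (@retraction_contra R X m K e (lam / (2 * (m * K)%:R)) L
  (fun t => g (t / (2 * (m * K)%:R))) r') => //.
- by rewrite divr_gt0.
- have unit (t : R) : 0 <= t <= 2 * (m * K)%:R -> 0 <= t / (2 * (m * K)%:R) <= 1.
    move=> /andP[t0 tN]; apply/andP; split; first exact: divr_ge0 t0 (ltW N0).
    by rewrite ler_pdivrMr // mul1r.
  move=> s t /unit s1 /unit t1; rewrite gE // -mulrBl normrM.
  by rewrite (gtr0_norm (x := _^-1)) ?invr_gt0 // mulrA mulrAC.
- move=> A B A0 B0; rewrite -nE => An Bn.
  by have := rL (insubd (FinSub A0P) A) (insubd (FinSub A0P) B);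
    rewrite !finsub_mdistE !insub_val.
- move=> A A0; rewrite -nE => An.
  have AP : (A != fset0) && (#|` A| <= n.-1)%N by rewrite A0.
  rewrite /r' (_ : insubd _ A = finsub_incl (leq_pred n) (FinSub AP)) ?rK //.
  by apply: val_inj; rewrite /= insub_val // (leq_trans An) // leq_pred.
move=> A A0; rewrite -nE => An; split; [exact: finsub_neq0|exact: finsub_card].
Qed.

Theorem theorem1p3 (R : realType) :
  (forall (X : normedModType R) (n : nat)
          (r : finsub (normed_metric X) n -> finsub (normed_metric X) n.-1),
     dim_ge X 1 -> (2 <= n)%N ->
     lipschitz_retraction (finsub_incl (leq_pred n)) r ->
     n%:R - 3 <= Lip r)
  /\
  (forall (X : metricType R) (n : nat)
          (r : finsub X n -> finsub X n.-1),
     hadamard_space X -> (exists x y : X, x <> y) -> (2 <= n)%N ->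
     lipschitz_retraction (finsub_incl (leq_pred n)) r ->
     n%:R - 3 <= Lip r).
Proof.
split=> [X n r [v vfree] | X n r [_ geo _] [x [y xy]]].
  have v0 : v ord0 != 0.
    apply/eqP => v0; have := vfree (fun=> 1); rewrite big_ord1 scale1r.
    by move=> /(_ v0 ord0)/eqP; rewrite oner_eq0.
  apply: (@geodesic_Lip_ge R (normed_metric X) (fun t => t *: v ord0) `|v ord0|).
    by rewrite normr_gt0.
  by move=> s t _ _; rewrite normed_mdistE -scalerBl normrZ mulrC.
have [g [gG g0 g1]] := geo x y.
apply: (@geodesic_Lip_ge R X g (mdist x y)); first by rewrite mdist_gt0; apply/eqP.
by move=> s t s1 t1; rewrite gG // g0 g1 mulrC.
Qed.
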